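(* Let $(X,\mathbb{X},\mu)$ be a measure space and let $p\in[1,\infty)$. Let $(f_n)$ be a sequence of measurable functions and $f$ a measurable function on $X$. For $\delta>0$ and $n\in\mathbb{N}$ let $E_n(\delta)=\{x\in X : |f_n(x)-f(x)|\ge\delta\}$, and let $E_n^c(\delta)$ be its complement in $X$. Then $(f_n)$ $\alpha_p$-converges to $f$ if and only if both of the following conditions hold: (a) $(f_n)$ converges to $f$ in measure; (b) there exists $\delta>0$ such that $\int_{E_n^c(\delta)}|f_n-f|^p\,d\mu\to 0$ as $n\to\infty$.
   Context: Measurable functions are $\mathbb{X}$-measurable real-valued functions on $X$; $(X,\mathbb{X},\mu)$ is an arbitrary measure space. For $B\in\mathbb{X}$, $B^c$ denotes the complement of $B$ in $X$. The sequence $(f_n)$ is said to $\alpha_p$-converge to $f$ if there exists a sequence of measurable sets $(B_n)$ with $\mu(B_n^c)\to 0$ as $n\to\infty$ such that $\int_{B_n}|f_n-f|^p\,d\mu\to 0$ as $n\to\infty$. The sequence $(f_n)$ converges to $f$ in measure if for every $\delta>0$, $\mu(\{x\in X : |f_n(x)-f(x)|\ge\delta\})\to 0$ as $n\to\infty$. *)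

(* Defs.v *)
From mathcomp Require Import all_boot all_order all_algebra.
From mathcomp Require Import all_classical all_reals all_analysis.

Set Implicit Arguments.
Unset Strict Implicit.
Unset Printing Implicit Defensive.

Import Order.TTheory GRing.Theory Num.Theory.
Import numFieldNormedType.Exports.

Local Open Scope classical_set_scope.
Local Open Scope ring_scope.

Section ModesOfConvergence.
Context (d : measure_display) (X : measurableType d) (R : realType).
Implicit Types (mu : {measure set X -> \bar R}) (fn : nat -> X -> R) (f : X -> R).

Definition dev_set fn f (delta : R) (n : nat) : set X :=
  [set x | delta <= `|fn n x - f x|].

Definition cvg_in_measure mu fn f : Prop :=
  forall delta : R, 0 < delta -> mu (dev_set fn f delta n) @[n --> \oo] --> 0%E.

(* The measures and integrals below are extended-real valued, so that
   convergence to [0%E] allows finitely many infinite terms. *)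
Definition int_dev_pow mu (p : R) fn f (n : nat) (B : set X) : \bar R :=
  (\int[mu]_(x in B) (`|fn n x - f x| `^ p)%:E)%E.

Definition alpha_cvg mu (p : R) fn f : Prop :=
  exists B : nat -> set X,
    [/\ forall n, measurable (B n),
        mu (~` B n) @[n --> \oo] --> 0%E
      & int_dev_pow mu p fn f n (B n) @[n --> \oo] --> 0%E].

End ModesOfConvergence.

(* Main.v *)
Require Import Defs.
From mathcomp Require Import all_boot all_order all_algebra.
From mathcomp Require Import all_classical all_reals all_analysis.
From mathcomp Require Import measurable_realfun.

Set Implicit Arguments.
Unset Strict Implicit.
Unset Printing Implicit Defensive.

Import Order.TTheory GRing.Theory Num.Theory.
Import numFieldNormedType.Exports.

Local Open Scope classical_set_scope.
Local Open Scope ring_scope.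

(** Write [g] for [fn n - f] and [E] for the set where [delta <= `|g|].  If (a)
    and (b) hold, the complements of the sets [E] are themselves exceptional
    sets witnessing alpha-convergence.  Conversely, let [B] be any measurable
    set and split along [B] and its complement.
    - The part of [E] outside [B] has measure at most [mu (~` B)], and on the
      part inside [B] Markov's inequality bounds the measure by
      [delta ^ -p] times the integral of [`|g| ^ p] over [B]
      ([measure_ge_le_setC_integral]).
    - The integral of [`|g| ^ p] over the part of [~` E] inside [B] is at most
      the integral over [B], and outside [B] the integrand is at most
      [delta ^ p], which contributes at most [delta ^ p * mu (~` B)]
      ([integral_lt_le_integral_setC]).
    When [B] runs through the sets given by alpha-convergence, both bounds tend
    to 0, for every [delta > 0]; so (b) in fact holds with any choice of
    [delta]. *)

Lemma cvge0_le_addZ (R : realType) (u v w : nat -> \bar R) (c : R) :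
  (forall n, (0 <= w n <= u n + c%:E * v n)%E) ->
  u n @[n --> \oo] --> 0%E -> v n @[n --> \oo] --> 0%E ->
  w n @[n --> \oo] --> 0%E.
Proof.
move=> hw u0 v0.
apply: (@squeeze_cvge _ _ _ _ (cst 0%E) _ (fun n => u n + c%:E * v n)%E).
- by apply: nearW => n; exact: hw.
- exact: cvg_cst.
- rewrite -[X in _ --> X]adde0 -[X in _ --> (_ + X)%E](mule0 c%:E).
  apply: cvgeD => //.
  exact: cvgeZl.
Qed.

Section SplitBounds.
Context (R : realType) (d : measure_display) (X : measurableType d).
Variables (mu : {measure set X -> \bar R}) (g : X -> R) (p delta : R).
Hypotheses (mg : measurable_fun [set: X] g) (p_ge0 : 0 <= p).
Hypothesis delta_gt0 : 0 < delta.

Let E := [set x | delta <= `|g x|].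

Lemma measurable_norm_ge : measurable E.
Proof.
rewrite -[E]setTI; apply: measurable_fun_le => //.
exact: measurableT_comp.
Qed.

Let measurable_norm_powR (D : set X) :
  measurable_fun D (EFin \o (fun x => `|g x| `^ p)).
Proof.
apply: (measurable_funS measurableT) => //.
apply/measurable_EFinP.
apply: (measurableT_comp (measurable_powR p)).
exact: measurableT_comp.
Qed.

(** Markov's inequality localized to [B]: only the integral over [B] is known to
    be small, and what [E] has outside [B] is paid for by [mu (~` B)]. *)
Lemma measure_ge_le_setC_integral (B : set X) : measurable B ->
  (mu E <= mu (~` B) +
    ((delta `^ p)^-1)%:E * \int[mu]_(x in B) (`|g x| `^ p)%:E)%E.
Proof.
move=> mB; have mE := measurable_norm_ge.
have mCB : measurable (~` B) by exact: measurableC.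
have mEB : measurable (E `&` B) by exact: measurableI.
have dp0 : 0 < delta `^ p by rewrite powR_gt0.
have leE : (mu E <= mu (~` B) + mu (E `&` B))%E.
  apply: le_trans (measureU2 mu mCB mEB).
  apply: le_measure; rewrite ?inE //; first exact: measurableU.
  by move=> x Ex; have [Bx|nBx] := pselect (B x); [right|left].
apply: le_trans leE _; apply: leeD2l.
rewrite lee_pdivlMl // -integral_cst //.
apply: (@le_trans _ _ (\int[mu]_(x in E `&` B) (`|g x| `^ p)%:E)%E).
  apply: ge0_le_integral => //.
  - by move=> x _; rewrite lee_fin ltW.
  - move=> x [Ex _]; rewrite lee_fin.
    by apply: ge0_ler_powR => //; rewrite nnegrE // ltW.
apply: ge0_subset_integral => //.
Qed.

(** Outside [E] the integrand is bounded by [delta ^ p], so that the smallness of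
    [mu (~` B)] makes up for the missing control of the integral off [B]. *)
Lemma integral_lt_le_integral_setC (B : set X) : measurable B ->
  (\int[mu]_(x in ~` E) (`|g x| `^ p)%:E <=
    \int[mu]_(x in B) (`|g x| `^ p)%:E + (delta `^ p)%:E * mu (~` B))%E.
Proof.
move=> mB; have mE := measurable_norm_ge.
have mCE : measurable (~` E) by exact: measurableC.
have mCB : measurable (~` B) by exact: measurableC.
have mECB : measurable (~` E `&` ~` B) by exact: measurableI.
have dp0 : (0 <= (delta `^ p)%:E)%E by rewrite lee_fin powR_ge0.
apply: (@le_trans _ _ (\int[mu]_(x in B `|` (~` E `&` ~` B))
    (`|g x| `^ p)%:E)%E).
  apply: ge0_subset_integral => //; first exact: measurableU.
  by move=> x Ex; have [Bx|nBx] := pselect (B x); [left|right].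
rewrite ge0_integral_setU //; last by apply/disj_setPS => x [Bx []].
apply: leeD2l.
apply: (@le_trans _ _ ((delta `^ p)%:E * mu (~` E `&` ~` B))%E).
  rewrite -integral_cst //; apply: ge0_le_integral => //.
  move=> x [/negP nEx _]; rewrite lee_fin.
  by apply: ge0_ler_powR; rewrite ?nnegrE // ltW // ltNge.
by apply: lee_wpmul2l => //; apply: le_measure; rewrite ?inE.
Qed.

End SplitBounds.

Theorem theorem4p2 (R : realType) (d : measure_display) (X : measurableType d)
    (mu : {measure set X -> \bar R}) (p : R) (hp : 1 <= p)
    (fn : nat -> X -> R) (f : X -> R)
    (mfn : forall n, measurable_fun [set: X] (fn n))
    (mf : measurable_fun [set: X] f) :
  alpha_cvg mu p fn f <->
  (cvg_in_measure mu fn f /\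
   exists2 delta : R, 0 < delta &
     int_dev_pow mu p fn f n (~` dev_set fn f delta n) @[n --> \oo] --> 0%E).
Proof.
have p_ge0 : 0 <= p by exact: le_trans hp.
have mg n : measurable_fun [set: X] (fun x => fn n x - f x).
  exact: measurable_funB.
split=> [[B [mB muB intB]]|[cvg_mu [delta delta_gt0 cvg_int]]].
- split=> [delta delta_gt0|].
  + apply: (cvge0_le_addZ (c := (delta `^ p)^-1) _ muB intB) => n.
    rewrite measure_ge0 /=.
    exact: (measure_ge_le_setC_integral mu (mg n)).
  + (* Any positive threshold would do. *)
    exists 1 => //.
    apply: (cvge0_le_addZ (c := 1 `^ p) _ intB muB) => n.
    apply/andP; split; last exact: (integral_lt_le_integral_setC mu (mg n)).
    by apply: integral_ge0 => x _; rewrite lee_fin powR_ge0.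
- exists (fun n => ~` dev_set fn f delta n); split=> //.
  + by move=> n; apply: measurableC; exact: (measurable_norm_ge _ (mg n)).
  + under eq_fun do rewrite setCK.
    exact: cvg_mu.
Qed.
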